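(* Let $p$ be a prime number, let $\mathbf f=f_1f_2f_3\dots$ be the Fibonacci word over $\{0,1\}$, and let $\xi_{\mathbf f,p}=\sum_{n\ge1}f_np^n\in\mathbb Z_p$. Let $\gamma=(1+\sqrt5)/2$. Then $$\mu(\xi_{\mathbf f,p})=\gamma^2,\qquad \mu^{\times}(\xi_{\mathbf f,p})\ge\gamma^2+\frac{1}{1+\gamma^2},\qquad \widehat{\mu}^{\times}(\xi_{\mathbf f,p})\ge 2+\frac{1}{2\gamma}.$$
   Context: The Fibonacci word $\mathbf f$ is the fixed point of the substitution $0\mapsto01$, $1\mapsto0$; it begins $010010100100101001010\dots$. For an irrational $p$-adic number $\xi$: $\mu(\xi)$ is the supremum of the real $\mu$ such that $0<|b\xi-a|_p\le\max\{|a|,|b|\}^{-\mu}$ has infinitely many solutions in nonzero integers $a,b$; $\mu^{\times}(\xi)$ is the supremum of the real $\mu$ such that $0<|b\xi-a|_p\le(|ab|^{1/2})^{-\mu}$ has infinitely many solutions in nonzero integers $a,b$; $\widehat{\mu}^{\times}(\xi)$ is the supremum of the real $\widehat\mu$ such that the system $0<|ab|^{1/2}\le X$, $|b\xi-a|_p\le X^{-\widehat\mu}$ has a solution in integers $a,b$ for every sufficiently large real $X$. *)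

(* Defs.v *)
From HB Require Import structures.
From mathcomp Require Import all_boot all_order all_algebra.
From mathcomp Require Import all_classical all_reals all_analysis.

Set Implicit Arguments.
Unset Strict Implicit.
Unset Printing Implicit Defensive.

Import Order.TTheory GRing.Theory Num.Theory.
Import numFieldNormedType.Exports.

Local Open Scope classical_set_scope.
Local Open Scope ring_scope.

(* Z_p as the inverse limit of the rings Z/p^n: [x n] is the representative of
   x modulo p^n in [0, p^n), and [padic_coh] says both that the residues are
   reduced and that they are compatible. *)
Record padic_int (p : nat) := PadicInt {
  residue :> nat -> int;
  padic_coh : forall n, (residue n.+1 %% p%:Z ^+ n)%Z = residue n }.

HB.instance Definition _ p := gen_eqMixin (padic_int p).
HB.instance Definition _ p := gen_choiceMixin (padic_int p).

Section PadicRing.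
Variable p : nat.
Implicit Types x y z : padic_int p.
Local Notation q n := (p%:Z ^+ n).

Lemma padic_ext x y : (forall n, x n = y n) -> x = y.
Proof.
case: x y => [u hu] [v hv] /= e; have {}e : u = v by apply/funext.
by subst v; congr PadicInt; apply: Prop_irrelevance.
Qed.

Lemma residue_mod x n : (x n %% q n)%Z = x n.
Proof. by rewrite -{1}(padic_coh x n) modz_mod padic_coh. Qed.

Lemma modq_S (a : int) n : ((a %% q n.+1)%Z %% q n)%Z = (a %% q n)%Z.
Proof. by rewrite {2}(divz_eq a (q n.+1)) !exprS mulrA modzMDl. Qed.

Lemma padic_mk_subproof (u : nat -> int) :
    (forall n, (u n.+1 = u n %[mod q n])%Z) ->
  forall n, ((u n.+1 %% q n.+1)%Z %% q n)%Z = (u n %% q n)%Z.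
Proof. by move=> h n; rewrite modq_S h. Qed.

Definition padic_mk u (h : forall n, (u n.+1 = u n %[mod q n])%Z) :=
  @PadicInt p (fun n => (u n %% q n)%Z) (padic_mk_subproof h).

Lemma padic0_subproof n : ((fun=> 0 : int) n.+1 = 0 %[mod q n])%Z.
Proof. by []. Qed.
Lemma padic1_subproof n : ((fun=> 1 : int) n.+1 = 1 %[mod q n])%Z.
Proof. by []. Qed.
Lemma padicN_subproof x n : (- x n.+1 = - x n %[mod q n])%Z.
Proof. by rewrite -modzNm padic_coh. Qed.
Lemma padicD_subproof x y n : (x n.+1 + y n.+1 = x n + y n %[mod q n])%Z.
Proof. by rewrite -modzDm !padic_coh. Qed.
Lemma padicM_subproof x y n : (x n.+1 * y n.+1 = x n * y n %[mod q n])%Z.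
Proof. by rewrite -modzMm !padic_coh. Qed.

Definition padic0 := padic_mk padic0_subproof.
Definition padic1 := padic_mk padic1_subproof.
Definition padicN x := padic_mk (padicN_subproof x).
Definition padicD x y := padic_mk (padicD_subproof x y).
Definition padicM x y := padic_mk (padicM_subproof x y).

Lemma padicDA : associative padicD.
Proof. by move=> x y z; apply: padic_ext => n /=; rewrite modzDml modzDmr addrA. Qed.
Lemma padicDC : commutative padicD.
Proof. by move=> x y; apply: padic_ext => n /=; rewrite addrC. Qed.
Lemma padic0D : left_id padic0 padicD.
Proof. by move=> x; apply: padic_ext => n /=; rewrite modzDml add0r residue_mod. Qed.
Lemma padicND : left_inverse padic0 padicN padicD.
Proof. by move=> x; apply: padic_ext => n /=; rewrite modzDml addNr. Qed.
Lemma padicMA : associative padicM.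
Proof. by move=> x y z; apply: padic_ext => n /=; rewrite modzMml modzMmr mulrA. Qed.
Lemma padicMC : commutative padicM.
Proof. by move=> x y; apply: padic_ext => n /=; rewrite mulrC. Qed.
Lemma padic1M : left_id padic1 padicM.
Proof. by move=> x; apply: padic_ext => n /=; rewrite modzMml mul1r residue_mod. Qed.
Lemma padicMDl : left_distributive padicM padicD.
Proof.
by move=> x y z; apply: padic_ext => n /=; rewrite modzMml modzDm mulrDl.
Qed.

HB.instance Definition _ :=
  GRing.isZmodule.Build (padic_int p) padicDA padicDC padic0D padicND.
HB.instance Definition _ :=
  GRing.Zmodule_isComPzRing.Build (padic_int p)
    padicMA padicMC padic1M padicMDl.

Lemma residue0 n : (0 : padic_int p) n = 0.
Proof. exact: mod0z. Qed.
Lemma residueD x y n : (x + y) n = ((x n + y n) %% q n)%Z.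
Proof. by []. Qed.
Lemma residueN x n : (- x) n = ((- x n) %% q n)%Z.
Proof. by []. Qed.
Lemma residueM x y n : (x * y) n = ((x n * y n) %% q n)%Z.
Proof. by []. Qed.

Lemma residue_nat (m n : nat) :
  (m%:R : padic_int p) n = (m%:Z %% q n)%Z.
Proof.
elim: m => [//|m IH]; rewrite -natr1 residueD IH [(1 : padic_int p) n]/=.
by rewrite modzDm -PoszD addn1.
Qed.

Lemma residue_int (a : int) n : (a%:~R : padic_int p) n = (a %% q n)%Z.
Proof.
case: a => m; first exact: residue_nat.
by rewrite NegzE mulrNz residueN residue_nat modzNm.
Qed.

Lemma residue_eq0W x m n : (m <= n)%N -> x n = 0 -> x m = 0.
Proof.
move=> le_mn; rewrite -(subnK le_mn); elim: (n - m)%N => [//|k IH] h.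
by apply: IH; rewrite -padic_coh -addSn h mod0z.
Qed.

End PadicRing.

Section PadicNorm.
Context (R : realType) (p : nat).
Implicit Types x : padic_int p.

(* The default value 0 of [padic_val] is only used at x = 0. *)
Definition padic_val x : nat :=
  xget 0%N [set n | x n = 0 /\ x n.+1 <> 0].

Definition padic_norm x : R :=
  if x == 0 then 0 else p%:R ^- padic_val x.

Context (p_prime : prime p).

Lemma padic_valP x : x != 0 -> x (padic_val x) = 0 /\ x (padic_val x).+1 <> 0.
Proof.
move=> x0; rewrite /padic_val; case: xgetP => [n -> //|none].
exfalso; move/eqP: x0; apply; apply: padic_ext.
elim=> [|n IH]; first by rewrite -(padic_coh x 0) expr0 modz1.
by rewrite !residue0 in IH *; apply: contrapT => h; exact: (none n (conj IH h)).
Qed.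

Lemma padic_norm_le x n : (padic_norm x <= p%:R ^- n) <-> x n = 0.
Proof.
have p1 : 1 < p%:R :> R by rewrite ltr1n prime_gt1.
have p0 : 0 < p%:R :> R by apply: lt_trans p1.
rewrite /padic_norm; case: eqVneq => [->|/padic_valP[v0 v1]].
  split=> _; first exact: residue0.
  by rewrite invr_ge0 exprn_ge0 // ltW.
rewrite lef_pV2 ?posrE ?exprn_gt0 // ler_eXn2l //; split=> [h|h].
  exact: residue_eq0W h v0.
by rewrite leqNgt; apply/negP => lt; apply/v1/(residue_eq0W lt h).
Qed.

Lemma padic_norm_int (a : int) :
  a != 0 -> padic_norm (a%:~R) = p%:R ^- logn p `|a|%N.
Proof.
move=> a0; have res n : ((a%:~R : padic_int p) n = 0) <-> (n <= logn p `|a|)%N.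
  rewrite residue_int; have -> : (n <= logn p `|a|)%N = (p%:Z ^+ n %| a)%Z.
    by rewrite -pfactor_dvdn ?absz_gt0 // dvdzE abszX.
  by split=> [h|h]; apply/dvdz_mod0P.
have nz : (a%:~R : padic_int p) != 0.
  apply/eqP => h; have := res (logn p `|a|).+1.
  by rewrite ltnn h => -[h' _]; have := h' (residue0 _ _).
rewrite /padic_norm (negPf nz); have [/res v0 v1] := padic_valP nz.
congr (_ ^- _); apply/eqP; rewrite eqn_leq v0 leqNgt.
by apply/negP => /res.
Qed.

End PadicNorm.

Section PadicSeries.
Variable p : nat.

Lemma padic_series_subproof (d : nat -> nat) n :
  (\sum_(i < n.+1) (d i)%:Z * p%:Z ^+ i =
   \sum_(i < n) (d i)%:Z * p%:Z ^+ i %[mod p%:Z ^+ n])%Z.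
Proof. by rewrite big_ord_recr /= addrC modzMDl. Qed.

(* The p-adic integer \sum_(i >= 0) d_i p^i. *)
Definition padic_series (d : nat -> nat) : padic_int p :=
  padic_mk (padic_series_subproof d).

Lemma padic_series_cvg (R : realType) (d : nat -> nat) : prime p ->
  (fun n => padic_norm R (\sum_(i < n) (d i)%:R * p%:R ^+ i - padic_series d))
    @ \oo --> (0 : R).
Proof.
move=> pp; have p1 : 1 < p%:R :> R by rewrite ltr1n prime_gt1.
have p0 : 0 < p%:R :> R by apply: lt_trans p1.
apply: (@squeeze_cvgr _ _ _ _ (cst 0) (fun n => (p%:R : R)^-1 ^+ n)).
- near=> n; apply/andP; split.
    by rewrite /padic_norm; case: ifP => // _; rewrite invr_ge0 exprn_ge0 // ltW.
  rewrite exprVn; apply/padic_norm_le => //.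
  rewrite residueD residueN modzDmr.
  have -> : \sum_(i < n) (d i)%:R * p%:R ^+ i =
     (\sum_(i < n) (d i)%:Z * p%:Z ^+ i)%:~R :> padic_int p.
    rewrite rmorph_sum /=; apply: eq_bigr => i _.
    by rewrite rmorphM rmorphXn /= -!pmulrn.
  by rewrite residue_int /= subrr mod0z.
- exact: cvg_cst.
- by apply: cvg_expr; rewrite ger0_norm ?invr_ge0 ?(ltW p0) // invf_lt1.
Unshelve. all: by end_near. Qed.

End PadicSeries.

(* The image of a finite word under a substitution, and the fixed points of a
   substitution among the infinite words w = w_0 w_1 w_2 ... *)
Definition subst_word (T : Type) (s : T -> seq T) (u : seq T) : seq T :=
  flatten (map s u).

Definition subst_fixed (T : Type) (s : T -> seq T) (w : nat -> T) : Prop :=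
  forall n, let u := subst_word s (mkseq w n) in u = mkseq w (size u).

(* The letter 0 is [false] and the letter 1 is [true]. *)
Definition fib_subst (b : bool) : seq bool :=
  if b then [:: false] else [:: false; true].

(* The limit of the words s^n(0), indexed from 0; s^n(0) has more than n
   letters and is a prefix of s^(n+1)(0). *)
Definition fib_word (n : nat) : bool :=
  nth false (iter n (subst_word fib_subst) [:: false]) n.

Section FibWord.
Local Notation W k := (iter k (subst_word fib_subst) [:: false]).

Lemma subst_word_cat u v :
  subst_word fib_subst (u ++ v) = subst_word fib_subst u ++ subst_word fib_subst v.
Proof. by rewrite /subst_word map_cat flatten_cat. Qed.

Lemma fib_iter_cons k : exists u, W k = false :: u.
Proof.
elim: k => [|k [u e]]; first by exists [::].
by exists (true :: subst_word fib_subst u); rewrite iterS e.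
Qed.

Lemma fib_iter_prefix k : exists v, W k.+1 = W k ++ v.
Proof.
elim: k => [|k [v e]]; first by exists [:: true].
by exists (subst_word fib_subst v); rewrite [LHS]iterS {1}e subst_word_cat.
Qed.

Lemma fib_iter_prefix_le m k : (m <= k)%N -> exists v, W k = W m ++ v.
Proof.
move=> h; rewrite -(subnK h); elim: (k - m)%N => [|j [v e]].
  by exists [::]; rewrite cats0.
have [v' e'] := fib_iter_prefix (j + m).
by exists (v ++ v'); rewrite addSn e' e catA.
Qed.

Lemma size_subst_word u : (size u <= size (subst_word fib_subst u))%N.
Proof.
elim: u => // b u IH.
by case: b => /=; rewrite ltnS; [exact: IH | exact: leqW].
Qed.

Lemma fib_iter_size k : (k < size (W k))%N.
Proof.
elim: k => // k IH; have [u e] := fib_iter_cons k.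
by move: IH; rewrite iterS e /= !ltnS => h; apply: leq_trans (size_subst_word u).
Qed.

Lemma fib_wordE k n : (n < size (W k))%N -> fib_word n = nth false (W k) n.
Proof.
move=> h; rewrite /fib_word; have h' := fib_iter_size n.
have [le|/ltnW le] := leqP n k; have [v e] := fib_iter_prefix_le le.
  by rewrite e nth_cat h'.
by rewrite e nth_cat h.
Qed.

Lemma fib_word_prefix k n : (n <= size (W k))%N -> mkseq fib_word n = take n (W k).
Proof.
move=> h; apply: (@eq_from_nth _ false).
  by rewrite size_mkseq size_takel.
move=> i; rewrite size_mkseq => lt; rewrite nth_mkseq // nth_take //.
by apply: fib_wordE; apply: leq_trans h.
Qed.

Lemma fib_word_fixedP w : subst_fixed fib_subst w <-> w = fib_word.
Proof.
split=> [fix_w|->].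
  have Ww k : W k = mkseq w (size (W k)).
    elim: k => [|k IH].
      by have := fix_w 1%N; rewrite /mkseq /= /subst_word /=; case w0: (w 0%N) => //=; rewrite w0.
    by rewrite iterS IH; apply: fix_w.
  apply/funext => n; have h := fib_iter_size n.
  by rewrite /fib_word Ww nth_mkseq.
move=> n /=; have h := ltnW (fib_iter_size n).
have e : W n.+1 = subst_word fib_subst (mkseq fib_word n) ++
                  subst_word fib_subst (drop n (W n)).
  by rewrite (fib_word_prefix h) -subst_word_cat cat_take_drop.
rewrite [RHS](@fib_word_prefix n.+1); last by rewrite e size_cat leq_addr.
by rewrite e take_size_cat.
Qed.

End FibWord.

(* \sum_(n >= 1) f_n p^n, where f_n = fib_word n.-1 since fib_word is indexed
   from 0. *)
Definition xi_fib (p : nat) : padic_int p :=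
  padic_series p (fun n => if n is m.+1 then nat_of_bool (fib_word m) else 0%N).

Section Exponents.
Context (R : realType) (p : nat).
Implicit Type xi : padic_int p.

(* The suprema are taken in the extended reals. *)

Definition mu xi : \bar R :=
  ereal_sup [set m%:E | m in [set m : R |
    infinite_set [set ab : int * int | let: (a, b) := ab in
      [/\ a != 0, b != 0, 0 < padic_norm R (b%:~R * xi - a%:~R) &
          padic_norm R (b%:~R * xi - a%:~R)
            <= Num.max `|a%:~R| `|b%:~R| `^ (- m)]]]].

Definition mu_times xi : \bar R :=
  ereal_sup [set m%:E | m in [set m : R |
    infinite_set [set ab : int * int | let: (a, b) := ab in
      [/\ a != 0, b != 0, 0 < padic_norm R (b%:~R * xi - a%:~R) &
          padic_norm R (b%:~R * xi - a%:~R)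
            <= Num.sqrt `|a%:~R * b%:~R| `^ (- m)]]]].

Definition mu_hat_times xi : \bar R :=
  ereal_sup [set m%:E | m in [set m : R |
    \forall X \near +oo, exists a b : int,
      [/\ 0 < Num.sqrt `|a%:~R * b%:~R| :> R,
          Num.sqrt `|a%:~R * b%:~R| <= X &
          padic_norm R (b%:~R * xi - a%:~R) <= X `^ (- m)]]].

End Exponents.

Definition golden (R : realType) : R := (1 + Num.sqrt 5) / 2.

(* Main.v *)
(* Let L_k be the length of s^k(0). The Fibonacci word has period L_k on its
   prefix of length L_(k+2) - 2 and again on the letters from L_(k+1) up to
   2 L_(k+2) - 2. If the digits of xi have period s from index r up to index N,
   then with b = 1 - p^s and a suitable a of size at most p^(r+s) one has
   |b xi - a|_p <= p^(-N). The first family of runs gives mu >= gamma^2, the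
   second one the bound for mu^x, and alternating both families the bound for
   the uniform exponent. The first family is also dense enough to bound mu from
   above: compare (a, b), not both divisible by p, with the approximation P/Q
   from the first level k whose run is long enough. If the integer b P - a Q is
   nonzero, its size bounds |b xi - a|_p below by about H^-2; otherwise p does
   not divide b, and |b xi - a|_p = |Q xi - P|_p is known exactly. *)
Require Import Defs.
From HB Require Import structures.
From mathcomp Require Import all_boot all_order all_algebra.
From mathcomp Require Import all_classical all_reals all_analysis.
From mathcomp Require Import zify ring lra.
Import Order.TTheory GRing.Theory Num.Theory.
Import numFieldNormedType.Exports.
Local Open Scope classical_set_scope.
Local Open Scope ring_scope.

(** * Combinatorics of the Fibonacci word: the lengths L_k, the periods, and where they break *)

Definition fib_len (k : nat) : nat :=
  size (iter k (subst_word fib_subst) [:: false]).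

Lemma fib_iter_rec k :
  iter k.+2 (subst_word fib_subst) [:: false] =
  iter k.+1 (subst_word fib_subst) [:: false] ++
  iter k (subst_word fib_subst) [:: false].
Proof.
elim: k => // k IH.
by rewrite [LHS]iterS [in LHS]IH subst_word_cat.
Qed.

Lemma fib_len_rec k : fib_len k.+2 = (fib_len k.+1 + fib_len k)%N.
Proof. by rewrite /fib_len fib_iter_rec size_cat. Qed.

Lemma fib_len_gt k : (k < fib_len k)%N.
Proof. exact: fib_iter_size. Qed.

Lemma fib_len_gt0 k : (0 < fib_len k)%N.
Proof. exact: leq_ltn_trans (fib_len_gt k). Qed.

Lemma fib_len_leS k : (fib_len k <= fib_len k.+1)%N.
Proof. by rewrite /fib_len iterS size_subst_word. Qed.

Lemma fib_len_mono : {homo fib_len : j k / (j <= k)%N}.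
Proof. by apply: homo_leq => //; [exact: leq_trans|exact: fib_len_leS]. Qed.

Lemma fib_word_shift k j :
  (j < fib_len k)%N -> fib_word (fib_len k.+1 + j) = fib_word j.
Proof.
move=> lt_j; rewrite (@fib_wordE k.+2); last first.
  by rewrite -/(fib_len _) fib_len_rec ltn_add2l.
by rewrite fib_iter_rec nth_cat ltnNge leq_addr /= addKn -fib_wordE.
Qed.

(** In the inductive step from k to k + 1, a large j is L_k + i. The period L_k identifies letters j
    and i, and the shift by L_(k+2) = L_(k+1) + L_k takes letter i to letter L_(k+1) + j. *)
Lemma fib_word_period k j :
  (j + 2 < fib_len k.+1)%N -> fib_word (fib_len k + j) = fib_word j.
Proof.
elim: k j => [|k IH] j lt_j; first by move: lt_j; rewrite /fib_len /=; lia.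
have [/fib_word_shift//|le_j] := ltnP j (fib_len k).
have rec := fib_len_rec k.
have lt_i : (j - fib_len k + 2 < fib_len k.+1)%N by lia.
rewrite -{2}(subnKC le_j) IH // -[in RHS](@fib_word_shift k.+1) ?rec;
  last by lia.
by congr fib_word; lia.
Qed.

(** The period L_k arises as L_(k+2) - L_(k+1): with j = L_(k+1) + i, both letters equal letter i,
    one by the prefix period L_(k+1), the other by L_(k+2). *)
Lemma fib_word_long_period k j :
  (fib_len k.+1 <= j)%N -> (j + 2 < fib_len k.+3)%N ->
  fib_word (fib_len k + j) = fib_word j.
Proof.
move=> le_j lt_j; have rec := fib_len_rec k; have rec' := fib_len_rec k.+1.
have gt := fib_len_gt k.+1.
rewrite -{2}(subnKC le_j) [RHS]fib_word_period; last by lia.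
rewrite -[RHS](@fib_word_period k.+2); last by lia.
by congr fib_word; lia.
Qed.

(** Since s^(k+2)(0) ends in s^k(0), the last but one letter depends only on the parity of k once
    the words have two letters. *)
Lemma fib_word_penult k : fib_word (fib_len k.+1 - 2) = odd k.
Proof.
elim/ltn_ind: k => -[|[|[|k]]] IH //.
have gt := fib_len_gt k.+2; have rec := fib_len_rec k.+2.
rewrite rec -addnBA; last by lia.
rewrite fib_word_shift; last by lia.
by rewrite IH //= !negbK.
Qed.

(** As L_(k+2) - 2 = L_k + (L_(k+1) - 2), the period L_k fails exactly where the range of
    [fib_word_period] ends. This yields the exact order of the early approximations. *)
Lemma fib_word_mismatch k :
  fib_word (fib_len k.+2 - 2) <> fib_word (fib_len k.+1 - 2).
Proof. by rewrite !fib_word_penult /=; case: odd. Qed.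

(** * Integer approximations to a series with digits 0 and 1, from periodic runs of digits *)

Section DigitSum.
Variables (p : nat) (d : nat -> nat).
Hypothesis p_gt1 : (1 < p)%N.
Hypothesis d_le1 : forall i, (d i <= 1)%N.

Definition digit_sum (n : nat) : int := \sum_(i < n) (d i)%:Z * p%:Z ^+ i.

Lemma digit_sumS n : digit_sum n.+1 = digit_sum n + (d n)%:Z * p%:Z ^+ n.
Proof. by rewrite /digit_sum big_ord_recr. Qed.

Lemma digit_sum_ge0 n : 0 <= digit_sum n.
Proof. by apply: sumr_ge0 => i _; apply: mulr_ge0 => //; apply: exprn_ge0. Qed.

Lemma digit_sum_lt n : digit_sum n < p%:Z ^+ n.
Proof.
elim: n => [|n IH]; first by rewrite /digit_sum big_ord0.
rewrite digit_sumS exprS.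
have dn : (d n)%:Z <= 1 by have := d_le1 n; lia.
have q0 : 0 < p%:Z ^+ n by apply: exprn_gt0; lia.
have p2 : 2 <= p%:Z by lia.
nia.
Qed.

Lemma digit_sum_mono m n : (m <= n)%N -> digit_sum m <= digit_sum n.
Proof.
move=> /subnKC <-; elim: (n - m)%N => [|q IH]; first by rewrite addn0.
rewrite addnS digit_sumS; apply: le_trans IH _; rewrite lerDl.
by apply: mulr_ge0 => //; apply: exprn_ge0.
Qed.

Lemma digit_sum_mod m n :
  (m <= n)%N -> (p%:Z ^+ m %| digit_sum n - digit_sum m)%Z.
Proof.
move=> /subnKC <-; elim: (n - m)%N => [|q IH].
  by rewrite addn0 subrr dvdz0.
rewrite addnS digit_sumS addrAC; apply: rpredD => //.
by rewrite exprD mulrA mulrAC dvdz_mull.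
Qed.

Lemma padic_seriesE n : padic_series p d n = (digit_sum n %% p%:Z ^+ n)%Z.
Proof. by []. Qed.

(** Turns p-adic smallness of a linear form into a divisibility between integers, where the
    approximations are constructed. *)
Lemma residue_linear_formP (a b : int) n :
  (b%:~R * padic_series p d - a%:~R) n = 0 <->
  (p%:Z ^+ n %| b * digit_sum n - a)%Z.
Proof.
rewrite residueD residueN residueM !residue_int padic_seriesE.
rewrite modzMm modzNm modzDm.
by split=> [h|h]; apply/dvdz_mod0P.
Qed.

(** If the period s lasted forever from index r on, the series would equal
    [run_num r s / run_den s]: multiplying by [1 - p ^ s] cancels the periodic tail. *)
Definition run_num (r s : nat) : int :=
  digit_sum (r + s) - p%:Z ^+ s * digit_sum r.
Definition run_den (s : nat) : int := 1 - p%:Z ^+ s.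

Lemma run_identity r s q :
  digit_sum (r + s + q) - p%:Z ^+ s * digit_sum (r + q) =
  run_num r s +
  \sum_(i < q) ((d (r + s + i))%:Z - (d (r + i))%:Z) * p%:Z ^+ (r + s + i).
Proof.
elim: q => [|q IH]; first by rewrite big_ord0 !addn0 addr0.
rewrite !addnS !digit_sumS big_ord_recr /= addrA -IH !exprD.
by ring.
Qed.

Lemma run_approx r s q :
  (forall i, (i < q)%N -> d (r + s + i) = d (r + i)) ->
  (p%:Z ^+ (r + s + q) %|
     run_den s * digit_sum (r + s + q) - run_num r s)%Z.
Proof.
move=> per; have := run_identity r s q.
rewrite big1 ?addr0 => [<-|i _]; last by rewrite per ?subrr ?mul0r.
have -> : run_den s * digit_sum (r + s + q) -
    (digit_sum (r + s + q) - p%:Z ^+ s * digit_sum (r + q)) =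
    - (p%:Z ^+ s * (digit_sum (r + s + q) - digit_sum (r + q))).
  by rewrite /run_den; ring.
rewrite rpredN -addnA addnCA exprD dvdz_mul //.
exact/digit_sum_mod/leq_addl.
Qed.

(** The first broken digit leaves a term (1 or -1) times p^(r+s+q), because digits are 0 or 1;
    everything else is divisible by a higher power of p. *)
Lemma run_approx_sharp r s q :
  (forall i, (i < q)%N -> d (r + s + i) = d (r + i)) ->
  d (r + s + q) <> d (r + q) ->
  ~~ (p%:Z ^+ (r + s + q).+1 %|
       run_den s * digit_sum (r + s + q).+1 - run_num r s)%Z.
Proof.
move=> per neq; have := run_identity r s q.+1.
rewrite big_ord_recr big1 /= ?add0r => [id|i _]; last first.
  by rewrite per ?subrr ?mul0r.
have E : run_den s * digit_sum (r + s + q).+1 - run_num r s =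
    ((d (r + s + q))%:Z - (d (r + q))%:Z) * p%:Z ^+ (r + s + q) -
     p%:Z ^+ s * (digit_sum (r + s + q).+1 - digit_sum (r + q).+1).
  by rewrite !addnS in id; rewrite /run_den; lra.
rewrite E rpredBr; last first.
  have -> : (r + s + q).+1 = (s + (r + q).+1)%N by lia.
  rewrite exprD dvdz_mul //.
  by apply: digit_sum_mod; lia.
rewrite exprS dvdz_mul2r; last by apply: expf_neq0; lia.
have [->|->] : (d (r + s + q))%:Z - (d (r + q))%:Z = 1 \/
    (d (r + s + q))%:Z - (d (r + q))%:Z = -1.
  by have := d_le1 (r + s + q); have := d_le1 (r + q); lia.
all: by rewrite dvdzE /= dvdn1; lia.
Qed.

Lemma run_num_lt r s : (`|run_num r s| < p ^ (r + s))%N.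
Proof.
rewrite -ltz_nat abszE -[Posz (p ^ _)]natz natrX natz.
have := digit_sum_lt (r + s); have := digit_sum_ge0 (r + s).
have := digit_sum_lt r; have := digit_sum_ge0 r.
have : 0 < p%:Z ^+ s by apply: exprn_gt0; lia.
rewrite /run_num exprD; move: (p%:Z ^+ s) (p%:Z ^+ r) => S Q.
by move: (digit_sum _) (digit_sum _) => A B *; nia.
Qed.

Lemma run_den_lt s : (0 < s)%N -> (`|run_den s| < p ^ s)%N.
Proof.
move=> s0; rewrite -ltz_nat abszE -[Posz (p ^ _)]natz natrX natz.
have : 1 < p%:Z ^+ s by rewrite exprn_egt1 ?lt0n_neq0 //; lia.
by rewrite /run_den; lia.
Qed.

Lemma run_den_neq0 s : (0 < s)%N -> run_den s != 0.
Proof.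
move=> s0; have : 1 < p%:Z ^+ s by rewrite exprn_egt1 ?lt0n_neq0 //; lia.
by rewrite /run_den; lia.
Qed.

(** A zero numerator would make p^s divide [digit_sum (r + s)], hence [digit_sum s], which lies
    strictly between 0 and p^s. *)
Lemma run_num_neq0 r s : 0 < digit_sum s -> run_num r s != 0.
Proof.
move=> pos; apply/eqP => eq0.
have : (p%:Z ^+ s %| digit_sum s)%Z.
  have -> : digit_sum s = - (digit_sum (r + s) - digit_sum s) +
       p%:Z ^+ s * digit_sum r.
    by move: eq0; rewrite /run_num; lra.
  apply: rpredD; last exact: dvdz_mulr.
  by rewrite rpredN digit_sum_mod // leq_addl.
have := digit_sum_lt s; case: (digit_sum s) pos => // m m0.
rewrite dvdzE abszX /= => lt_m /(dvdn_leq m0).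
by apply/negP; rewrite -ltnNge -ltz_nat -[Posz (p ^ s)]natz natrX natz.
Qed.

End DigitSum.

(** * The early and late approximations to the Fibonacci series, and a gap principle for linear
    forms *)

Definition fib_digit (n : nat) : nat :=
  if n is m.+1 then nat_of_bool (fib_word m) else 0%N.

Lemma fib_digit_le1 i : (fib_digit i <= 1)%N.
Proof. by case: i => //= i; exact: leq_b1. Qed.

Lemma fib_len_gt1 k : (1 < fib_len k.+1)%N.
Proof. by have := fib_len_gt k.+1; lia. Qed.

Section Approximations.
Variable p : nat.
Hypothesis p_prime : prime p.
Local Notation T := (digit_sum p fib_digit).

Let p_gt1 : (1 < p)%N := prime_gt1 p_prime.

Lemma linear_form_dvd_le (a b : int) m n : (m <= n)%N ->
  (p%:Z ^+ n %| b * T n - a)%Z -> (p%:Z ^+ m %| b * T m - a)%Z.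
Proof.
move=> le_mn /(dvdz_trans (dvdz_exp2l p%:Z le_mn)) dvd_n.
have -> : b * T m - a = (b * T n - a) - b * (T n - T m) by ring.
by apply: rpredB => //; apply/dvdz_mull/digit_sum_mod.
Qed.

Definition fib_den k : int := run_den p (fib_len k).
(** Digit n + 1 is letter n, so the run starting at letter 0 has r = 1, and the late run, starting
    at letter L_(k+1), has r = L_(k+1) + 1. *)
Definition fib_num k : int := run_num p fib_digit 1 (fib_len k).
Definition fib_num_late k : int :=
  run_num p fib_digit (fib_len k.+1).+1 (fib_len k).

Lemma fib_run_early k i : (i < fib_len k.+1 - 2)%N ->
  fib_digit (1 + fib_len k + i) = fib_digit (1 + i).
Proof. by move=> lt_i; rewrite /= fib_word_period //; lia. Qed.

Lemma fib_approx_early k :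
  (p%:Z ^+ (fib_len k.+2 - 1) %|
     fib_den k * T (fib_len k.+2 - 1) - fib_num k)%Z.
Proof.
have := run_approx p fib_digit _ _ _ (fib_run_early k).
have -> // : (1 + fib_len k + (fib_len k.+1 - 2) = fib_len k.+2 - 1)%N.
by rewrite fib_len_rec; have := fib_len_gt1 k; lia.
Qed.

Lemma fib_approx_early_sharp k :
  ~~ (p%:Z ^+ fib_len k.+2 %| fib_den k * T (fib_len k.+2) - fib_num k)%Z.
Proof.
have gt1 := fib_len_gt1 k.
have eN : (fib_len k + (fib_len k.+1 - 2) = fib_len k.+2 - 2)%N.
  by rewrite fib_len_rec; lia.
have neq : fib_digit (1 + fib_len k + (fib_len k.+1 - 2)) <>
    fib_digit (1 + (fib_len k.+1 - 2)).
  rewrite /= eN => eq_d; apply: (fib_word_mismatch k); move: eq_d.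
  by case: fib_word; case: fib_word.
have := run_approx_sharp p fib_digit p_gt1 fib_digit_le1 _ _ _
  (fib_run_early k) neq.
have -> // : (1 + fib_len k + (fib_len k.+1 - 2)).+1 = fib_len k.+2.
by rewrite -addnA eN; have := fib_len_gt1 k.+1; lia.
Qed.

Lemma fib_approx_late k :
  (p%:Z ^+ (2 * fib_len k.+2 - 1) %|
     fib_den k * T (2 * fib_len k.+2 - 1) - fib_num_late k)%Z.
Proof.
have rec := fib_len_rec k; have rec' := fib_len_rec k.+1.
have gt1 := fib_len_gt1 k.
have per i : (i < fib_len k.+2 - 2)%N ->
    fib_digit ((fib_len k.+1).+1 + fib_len k + i) =
    fib_digit ((fib_len k.+1).+1 + i).
  move=> lt_i; rewrite /= addnAC addnC fib_word_long_period //; lia.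
have := run_approx p fib_digit _ _ _ per.
have -> // : ((fib_len k.+1).+1 + fib_len k + (fib_len k.+2 - 2) =
  2 * fib_len k.+2 - 1)%N by lia.
Qed.

Lemma fib_den_lt k : (`|fib_den k| < p ^ fib_len k)%N.
Proof. by apply: run_den_lt => //; apply: leq_ltn_trans (fib_len_gt k). Qed.

Lemma fib_num_lt k : (`|fib_num k| < p ^ (fib_len k).+1)%N.
Proof. exact: run_num_lt p fib_digit p_gt1 fib_digit_le1 _ _. Qed.

Lemma fib_num_late_lt k : (`|fib_num_late k| < p ^ (fib_len k.+2).+1)%N.
Proof.
by rewrite fib_len_rec -addSn; exact: run_num_lt p fib_digit p_gt1 fib_digit_le1 _ _.
Qed.

Lemma fib_den_neq0 k : fib_den k != 0.
Proof. by apply: run_den_neq0 => //; apply: leq_ltn_trans (fib_len_gt k). Qed.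

(** The first nonzero digit has index 2, and L_k is at least 3 for k > 1. *)
Lemma fib_digit_sum_gt0 k : (1 < k)%N -> 0 < T (fib_len k).
Proof.
move=> k1; have := fib_len_gt k => gt.
have T3 : T 3 = p%:Z ^+ 2.
  rewrite !digit_sumS /digit_sum big_ord0 -[fib_digit 0]/0%N.
  rewrite -[fib_digit 1]/0%N -[fib_digit 2]/1%N !mul0r mul1r !add0r.
  by [].
apply: lt_le_trans (@digit_sum_mono p fib_digit 3 _ _); last by lia.
by rewrite T3 exprn_gt0 ?ltz_nat ?prime_gt0.
Qed.

Lemma fib_num_neq0 k : (1 < k)%N -> fib_num k != 0.
Proof. by move=> k1; apply: run_num_neq0 => //;
  [exact: fib_digit_le1|exact: fib_digit_sum_gt0]. Qed.

Lemma fib_num_late_neq0 k : (1 < k)%N -> fib_num_late k != 0.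
Proof. by move=> k1; apply: run_num_neq0 => //;
  [exact: fib_digit_le1|exact: fib_digit_sum_gt0]. Qed.

Lemma fib_den_gt k : (k < `|fib_den k|)%N.
Proof.
have lt_k := fib_len_gt k; have := ltn_expl (fib_len k) p_gt1.
rewrite /fib_den /run_den -ltz_nat -[Posz (p ^ _)]natz natrX natz.
by move: (p%:Z ^+ _) => q; lia.
Qed.

(** If n reached L_(k+2), the determinant D of (a, b) and the early approximation (P, Q) would be
    divisible by a power of p exceeding its size, so D = 0. Then Q (b T - a) = b (Q T - P) with b
    prime to p contradicts [fib_approx_early_sharp]. *)
Lemma linear_form_bound_coprime (a b : int) (H n : nat) :
  (`|a| <= H)%N -> (`|b| <= H)%N ->
  ~~ ((p%:Z %| a)%Z && (p%:Z %| b)%Z) ->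
  (p%:Z ^+ n %| b * T n - a)%Z ->
  exists2 k, (p ^ fib_len k <= p ^ 3 * H)%N &
    (n <= fib_len k.+2 - 1)%N || (p ^ n <= p ^ 5 * H ^ 2)%N.
Proof.
move=> aH bH ndvd dvd_n.
have H0 : (0 < H)%N.
  rewrite lt0n; apply: contra ndvd => /eqP H0.
  have -> : a = 0 by lia.
  have -> : b = 0 by lia.
  by rewrite dvdz0.
(* The least such k is used: the inequality itself makes D small, and its failure one level below
   bounds p^L_k. *)
have ex_k : exists k, (p ^ 3 * H <= p ^ fib_len k.+1)%N.
  exists (H + 2)%N; apply: (@leq_trans (p ^ (3 + H))); last first.
    by rewrite leq_exp2l //; have := fib_len_gt (H + 2).+1; lia.
  by rewrite expnD leq_mul2l ltnW ?orbT // ltn_expl.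
case: (ex_minnP ex_k) => k le_k min_k.
have kH : (p ^ fib_len k <= p ^ 3 * H)%N.
  (* Minimality says nothing at k = 0, but there L_0 = 1. *)
  case: k le_k min_k => [|k] _ min_k.
    apply: (@leq_trans (p ^ 3)); first by rewrite leq_exp2l.
    by rewrite leq_pmulr.
  by rewrite leqNgt; apply/negP => /ltnW /min_k; rewrite ltnn.
exists k => //; case: leqP => //= lt_n.
pose Q := fib_den k; pose P := fib_num k; pose D : int := b * P - a * Q.
have dvd_m m : (m <= n)%N -> (m <= fib_len k.+2 - 1)%N ->
    (p%:Z ^+ m %| D)%Z.
  move=> le_n le_N; have -> : D = Q * (b * T m - a) - b * (Q * T m - P).
    by rewrite /D; ring.
  apply: rpredB; apply: dvdz_mull; first exact: linear_form_dvd_le dvd_n.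
  exact: linear_form_dvd_le le_N (fib_approx_early k).
(* Here |D| <= (p + 1) H p^L_k < p^2 H p^L_k. The third factor p in [p ^ 3 * H] pays for the
   exponent L_(k+2) - 1 instead of L_(k+2). *)
have D_lt : (`|D| < p ^ (fib_len k.+2 - 1))%N.
  have := fib_num_lt k; have := fib_den_lt k; rewrite -/P -/Q => Q_lt P_lt.
  have {}P_lt : (`|(b * P)%R| <= H * (p * p ^ fib_len k))%N.
    by rewrite abszM leq_mul // -expnS ltnW.
  have {}Q_lt : (`|(a * Q)%R| <= H * p ^ fib_len k)%N.
    by rewrite abszM leq_mul // ltnW.
  have lt_D : (`|D| < p ^ 2 * H * p ^ fib_len k)%N.
    apply: (@leq_ltn_trans (H * (p * p ^ fib_len k) + H * p ^ fib_len k)).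
      apply: leq_trans (leq_add P_lt Q_lt); rewrite /D.
      by move: (b * P) (a * Q); clear; lia.
    have q0 : (0 < H * p ^ fib_len k)%N by rewrite muln_gt0 H0 expn_gt0; lia.
    rewrite -mulnA mulnCA addnC -mulSn ltn_pmul2r // -mulnn.
    by apply: (@leq_trans (2 * p)); rewrite ?leq_mul2r ?p_gt1 ?orbT //; lia.
  have p0 : (0 < p)%N by lia.
  rewrite -(ltn_pmul2l p0);
    apply: leq_trans (_ : p ^ 3 * H * p ^ fib_len k <= _)%N.
    rewrite [X in (_ < X)%N](_ : _ = p * (p ^ 2 * H * p ^ fib_len k))%N.
      by rewrite ltn_pmul2l.
    by ring.
  rewrite -expnS subn1 prednK ?fib_len_gt0 // fib_len_rec expnD.
  by rewrite leq_mul2r le_k orbT.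
have D0 : D = 0.
  apply/eqP; rewrite -absz_eq0 -leqn0 leqNgt; apply/negP => D_gt0.
  have := dvd_m _ (ltnW lt_n) (leqnn _).
  by rewrite dvdzE abszX => /(dvdn_leq D_gt0); rewrite leqNgt D_lt.
have pQ : ~~ (p%:Z %| Q)%Z.
  apply/negP => pQ; suff : (p%:Z %| (1%R : int))%Z by rewrite dvdz1 /=; lia.
  have -> : 1 = Q + p%:Z ^+ fib_len k by rewrite /Q /fib_den /run_den subrK.
  apply: rpredD => //; rewrite dvdz_exp ?dvdzz //.
  exact: leq_ltn_trans (fib_len_gt k).
(* If p divided b, then D = 0 would make p divide a Q, hence a, as Q is prime to p. *)
have pb : ~~ (p%:Z %| b)%Z.
  apply: contra ndvd => pb; rewrite pb andbT.
  have : (p%:Z %| a * Q)%Z.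
    have -> : a * Q = b * P - D by rewrite /D; ring.
    by rewrite D0 subr0 dvdz_mulr.
  by rewrite !dvdzE abszM Euclid_dvdM // => /orP[//|]; rewrite -dvdzE (negPf pQ).
have le_n : (fib_len k.+2 <= n)%N.
  by rewrite -(prednK (fib_len_gt0 k.+2)) -subn1.
have := linear_form_dvd_le a b _ _ le_n dvd_n.
move=> /(dvdz_mull Q).
have -> : Q * (b * T (fib_len k.+2) - a) = b * (Q * T (fib_len k.+2) - P) + D.
  by rewrite /D; ring.
rewrite D0 addr0 Gauss_dvdzr; last first.
  rewrite coprimezE abszX /= coprimeXl // prime_coprime //.
by rewrite (negPf (fib_approx_early_sharp k)).
Qed.
End Approximations.

(** * Golden ratio estimates for L_k, and criteria for suprema and for infinite sets of pairs *)

Section Golden.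
Variable R : realType.
Local Notation g := (golden R).

Lemma golden_sqr : g ^+ 2 = g + 1.
Proof.
have s5 : Num.sqrt 5 ^+ 2 = 5 :> R by rewrite sqr_sqrtr.
by rewrite /golden; move: s5; move: (Num.sqrt _) => s; lra.
Qed.

Lemma golden_bounds : 8 / 5 < g < 13 / 8.
Proof.
have s5 : Num.sqrt 5 ^+ 2 = 5 :> R by rewrite sqr_sqrtr.
have s0 := sqrtr_ge0 (5 : R).
rewrite /golden; move: s5 s0; move: (Num.sqrt _) => s s5 s0.
by apply/andP; split; nra.
Qed.

Lemma fib_lenSS (k : nat) :
  (fib_len k.+2)%:R = (fib_len k.+1)%:R + (fib_len k)%:R :> R.
Proof. by rewrite fib_len_rec natrD. Qed.

(** The defect L_(k+1) - g L_k starts at 2 - g and is multiplied by 1 - g, of absolute value below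
    1, at each step. *)
Lemma fib_len_golden (k : nat) :
  `|(fib_len k.+1)%:R - g * (fib_len k)%:R| <= 1.
Proof.
have /andP[g1 g2] := golden_bounds; have gg := golden_sqr.
elim: k => [|k IH].
  by rewrite ler_norml /fib_len /=; apply/andP; split; lra.
have -> : (fib_len k.+2)%:R - g * (fib_len k.+1)%:R =
    (1 - g) * ((fib_len k.+1)%:R - g * (fib_len k)%:R).
  have := congr1 (fun x => x * (fib_len k)%:R) gg.
  by rewrite fib_lenSS; lra.
rewrite normrM -[leRHS]mulr1 ler_pM // ler_norml; apply/andP; split; lra.
Qed.

Lemma fib_len_large (e C : R) : 0 < e ->
  exists K, forall k, (K <= k)%N -> C <= e * (fib_len k)%:R.
Proof.
move=> e0; exists (Num.bound `|C / e|) => k le_k.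
rewrite mulrC -ler_pdivrMr //; apply: le_trans (ler_norm _) _.
apply: le_trans (ltW (archi_boundP (normr_ge0 _))) _.
by rewrite ler_nat; apply: leq_trans le_k (ltnW (fib_len_gt k)).
Qed.

(** The auxiliary bound u allows every candidate exponent m to be taken positive, or above 1. *)
Lemma le_ereal_sup_fin (u t : R) (S : set R) : u < t ->
  (forall m, u < m < t -> S m) -> (t%:E <= ereal_sup [set m%:E | m in S])%E.
Proof.
move=> lt_ut inS; apply/lee_subgt0Pr => e e0.
apply: (@le_trans _ _ (Num.max (t - e) ((u + t) / 2))%:E).
  by rewrite -EFinB lee_fin le_max lexx.
apply: ereal_sup_ubound; exists (Num.max (t - e) ((u + t) / 2)) => //.
apply: inS; rewrite lt_max gt_max; apply/andP; split.
  by apply/orP; right; lra.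
by apply/andP; split; lra.
Qed.

Lemma infinite_int_pairs (S : set (int * int)) :
  (forall M, exists2 ab, S ab & (M < `|ab.2|)%N) -> infinite_set S.
Proof.
move=> unb /finite_seqP[s defS].
have [ab] := unb (\max_(x <- s) `|x.2|)%N.
rewrite defS /= => ab_s; rewrite ltnNge => /negP; apply.
exact: (@leq_bigmax_seq _ s xpredT (fun x => `|x.2|%N)).
Qed.

Lemma finite_int_pairs (M : nat) :
  finite_set [set ab : int * int | (`|ab.1| <= M)%N /\ (`|ab.2| <= M)%N].
Proof.
have finM : finite_set [set a : int | (`|a| <= M)%N].
  apply: (@sub_finite_set _ _ ((fun i : nat => i%:Z - M%:Z) @` `I_(M + M).+1)).
    move=> a /= aM; exists `|(a + M%:Z)%R|%N => /=; lia.
  by apply: finite_image; exact: finite_II.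
by apply: sub_finite_set (finite_setX finM finM) => -[].
Qed.

End Golden.

(** * Bounds for the three exponents *)

Section Exponents.
Variables (R : realType) (p : nat).
Hypothesis p_prime : prime p.
Local Notation g := (golden R).
Local Notation xi := (xi_fib p).
Local Notation T := (digit_sum p fib_digit).

Let p_gt1 : (1 < p)%N := prime_gt1 p_prime.

Let p_ge1 : 1 <= p%:R :> R.
Proof. by rewrite ler1n prime_gt0. Qed.

Let p_gt0 : 0 < p%:R :> R.
Proof. by rewrite ltr0n prime_gt0. Qed.

Lemma xi_fib_residueP (a b : int) n :
  (b%:~R * xi - a%:~R) n = 0 <-> (p%:Z ^+ n %| b * T n - a)%Z.
Proof. exact: residue_linear_formP. Qed.

(** Common factors p are removed by induction on n: each costs one p on the left and p^(g^2) >= p on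
    the right. In the coprime case L_(k+2) - 1 <= g^2 L_k. *)
Lemma linear_form_bound (a b : int) (H n : nat) :
  (`|a| <= H)%N -> (`|b| <= H)%N -> (a != 0) || (b != 0) ->
  (p%:Z ^+ n %| b * T n - a)%Z ->
  (p ^ n)%:R <= (p ^ 3 * H)%:R `^ (g ^+ 2) :> R.
Proof.
have /andP[g1 g2] := golden_bounds R; have gg := golden_sqr R.
have gg2 : 2 <= g ^+ 2 by rewrite gg; lra.
elim: n a b H => [|n IH] a b H aH bH ab0 dvd_n.
  rewrite expn0 -[leLHS](powRr0 (p ^ 3 * H)%:R); apply: ler_powR; last by lra.
  by rewrite ler1n muln_gt0 expn_gt0 ltnW //=; lia.
have [/andP[pa pb]|ndvd] := boolP ((p%:Z %| a)%Z && (p%:Z %| b)%Z).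
  case/dvdzP: pa => a' def_a; case/dvdzP: pb => b' def_b.
  have le_n : (p ^ n)%:R <= (p ^ 3 * (H %/ p))%:R `^ (g ^+ 2) :> R.
    apply: (IH a' b').
    - by rewrite leq_divRL ?prime_gt0 //; move: aH; rewrite def_a abszM.
    - by rewrite leq_divRL ?prime_gt0 //; move: bH; rewrite def_b abszM.
    - move: ab0; apply: contraLR; rewrite !negb_or !negbK def_a def_b.
      by move=> /andP[/eqP-> /eqP->]; rewrite mul0r eqxx.
    have -> : b' * T n - a' = (b' * T n.+1 - a') - b' * (T n.+1 - T n) by ring.
    apply: rpredB; last by apply/dvdz_mull/digit_sum_mod.
    have pz : p%:Z != 0 by lia.
    rewrite -(dvdz_mul2r pz) -exprSr.
    have -> // : (b' * T n.+1 - a') * p%:Z = b * T n.+1 - a.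
    by rewrite def_a def_b; ring.
  rewrite expnS natrM.
  apply: (@le_trans _ _ (p%:R `^ (g ^+ 2) * (p ^ 3 * (H %/ p))%:R `^ (g ^+ 2))).
    apply: ler_pM => //; apply: le1r_powR => //.
    by apply: le_trans gg2; rewrite ler1n.
  rewrite -powRM //; apply: ge0_ler_powR; rewrite ?nnegrE ?mulr_ge0 //.
  by rewrite -natrM ler_nat mulnCA leq_mul2l mulnC leq_divM orbT.
have [k le_k bnd] :=
  linear_form_bound_coprime p p_prime a b H n.+1 aH bH ndvd dvd_n.
have x1 : 1 <= (p ^ 3 * H)%:R :> R.
  by rewrite ler1n; apply: leq_trans le_k; rewrite expn_gt0 prime_gt0.
have x0 : 0 <= (p ^ 3 * H)%:R :> R by [].
case/orP: bnd => [le_n|le_n].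
  apply: (@le_trans _ _ ((p ^ fib_len k)%:R `^ (g ^+ 2))); last first.
    by rewrite ge0_ler_powR ?nnegrE ?ler_nat //; lra.
  rewrite !natrX -!(powR_mulrn _ (ltW p_gt0)) -powRrM ler_powR //.
  have /ler_normlP[_ dist] := fib_len_golden R k.
  have : (n.+1)%:R + 1 <= (fib_len k.+2)%:R :> R.
    by rewrite natr1 ler_nat (leq_ltn_trans le_n) // ltn_subrL fib_len_gt0.
  by rewrite fib_lenSS gg; lra.
apply: (@le_trans _ _ ((p ^ 3 * H)%:R `^ 2%:R)); last by rewrite ler_powR.
rewrite powR_mulrn // -natrX ler_nat; apply: leq_trans le_n _.
by rewrite expnMn -expnM leq_mul2r leq_exp2l ?orbT.
Qed.

Lemma linear_form_neq0 (a b : int) :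
  (a != 0) || (b != 0) -> b%:~R * xi - a%:~R != 0.
Proof.
move=> ab0; apply/eqP => x0.
pose H := maxn `|a| `|b|; pose C : R := (p ^ 3 * H)%:R `^ (g ^+ 2).
have bnd n : (p ^ n)%:R <= C.
  apply: (linear_form_bound a b) => //; rewrite ?leq_maxl ?leq_maxr //.
  by apply/xi_fib_residueP; rewrite x0 residue0.
have := bnd (Num.bound C); apply/negP; rewrite -ltNge.
apply: lt_trans (archi_boundP (powR_ge0 _ _)) _.
by rewrite ltr_nat ltn_expl.
Qed.

Lemma padic_norm_linear_form_gt0 (a b : int) :
  (a != 0) || (b != 0) -> 0 < padic_norm R (b%:~R * xi - a%:~R).
Proof.
move=> /linear_form_neq0 x0.
by rewrite /padic_norm (negPf x0) invr_gt0 exprn_gt0.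
Qed.

(** Common frame of the lower bounds: with height at most p^c and order at least N, only the
    comparison of c m with N remains. *)
Lemma padic_norm_le_powR (x : padic_int p) (N : nat) (h c m : R) :
  0 < h -> h <= p%:R `^ c -> 0 <= m -> c * m <= N%:R -> x N = 0 ->
  padic_norm R x <= h `^ (- m).
Proof.
move=> h0 hc m0 cm /(padic_norm_le R p_prime) /le_trans; apply.
rewrite powRN lef_pV2 ?posrE ?exprn_gt0 ?powR_gt0 // -(powR_mulrn _ (ltW p_gt0)).
apply: (@le_trans _ _ ((p%:R `^ c) `^ m)).
  by rewrite ge0_ler_powR // nnegrE ?powR_ge0 // ltW.
by rewrite -powRrM ler_powR.
Qed.

Lemma mu_ge : ((g ^+ 2)%:E <= mu R xi)%E.
Proof.
have /andP[g1 g2] := golden_bounds R; have gg := golden_sqr R.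
apply: (le_ereal_sup_fin _ 0); first by rewrite gg; lra.
move=> m /andP[m0 mg]; apply: infinite_int_pairs => M.
(* The goal (L_k + 1) m <= L_(k+2) - 1 follows from L_(k+2) >= g^2 L_k - 1 once (g^2 - m) L_k >= m +
   2. *)
have [K large] := fib_len_large R (g ^+ 2 - m) (m + 2)
  ltac:(by rewrite subr_gt0).
pose k := maxn 2 (maxn M K).
have k2 : (1 < k)%N by rewrite leq_max.
have {}large := large k ltac:(by rewrite !leq_max leqnn !orbT).
exists (fib_num p k, fib_den p k); last first.
  by apply: leq_ltn_trans (fib_den_gt p p_prime k); rewrite !leq_max leqnn !orbT.
have num0 := fib_num_neq0 p p_prime k k2; have den0 := fib_den_neq0 p p_prime k.
split=> //; first by rewrite padic_norm_linear_form_gt0 ?num0.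
apply: (padic_norm_le_powR _ (fib_len k.+2 - 1) _ (fib_len k + 1)%:R).
- by rewrite lt_max normr_gt0 intr_eq0 num0.
- rewrite powR_mulrn // -!intr_norm ge_max -!natr_absz -!natrX !ler_nat addn1.
  rewrite ltnW ?fib_num_lt //=.
  by apply: leq_trans (ltnW (fib_den_lt p p_prime k)) _; rewrite leq_exp2l.
- exact: ltW.
- have /ler_normlP[dist _] := fib_len_golden R k.
  rewrite natrB; last by rewrite ltnW ?fib_len_gt1.
  by rewrite natrD fib_lenSS; rewrite gg in large; lra.
by apply/xi_fib_residueP; exact: fib_approx_early.
Qed.

Lemma mu_le : (mu R xi <= (g ^+ 2)%:E)%E.
Proof.
have /andP[g1 g2] := golden_bounds R; have gg := golden_sqr R.
apply: ge_ereal_sup => _ [m inf_m <-]; rewrite lee_fin leNgt; apply/negP => gt_m.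
(* From H^m <= p^v <= (p^3 H)^(g^2) one gets H^(m - g^2) <= p^(3 g^2), that is, H <= C. *)
pose C : R := ((p ^ 3)%:R `^ (g ^+ 2)) `^ (m - g ^+ 2)^-1.
apply: inf_m; apply: sub_finite_set (finite_int_pairs (Num.bound C)) => -[a b].
move=> [a0 b0 pos le_norm] /=.
pose H := maxn `|a| `|b|.
suff : (H <= Num.bound C)%N by rewrite geq_max => /andP.
have HE : Num.max `|a%:~R| `|b%:~R| = H%:R :> R.
  by rewrite natr_max !natr_absz !intr_norm.
have H1 : 1 <= H%:R :> R by rewrite ler1n /H leq_max !lt0n !absz_eq0 a0.
have x0 := linear_form_neq0 a b ltac:(by rewrite a0).
have [v0 _] := padic_valP x0.
move: le_norm; rewrite HE /padic_norm (negPf x0); set v := padic_val _ => le_norm.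
have bnd : (p ^ v)%:R <= (p ^ 3 * H)%:R `^ (g ^+ 2) :> R.
  apply: (linear_form_bound a b); rewrite ?leq_maxl ?leq_maxr ?a0 //.
  exact/xi_fib_residueP.
have {le_norm} : H%:R `^ m <= (p ^ v)%:R.
  move: le_norm; rewrite powRN lef_pV2 ?natrX // posrE ?exprn_gt0 //.
  by rewrite powR_gt0 // (lt_le_trans ltr01).
move=> /le_trans/(_ bnd); rewrite natrM powRM // => le_H.
have {}le_H : H%:R `^ (m - g ^+ 2) <= (p ^ 3)%:R `^ (g ^+ 2).
  rewrite powRB; last by rewrite (gt_eqF (lt_le_trans ltr01 H1)) implybT.
  by rewrite ler_pdivrMr // powR_gt0 // (lt_le_trans ltr01).
have m0 : 0 < m - g ^+ 2 by rewrite subr_gt0.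
have le_HC : H%:R <= C.
  have -> : H%:R = (H%:R `^ (m - g ^+ 2)) `^ (m - g ^+ 2)^-1.
    by rewrite -powRrM divff ?gt_eqF // powRr1.
  by rewrite ge0_ler_powR ?nnegrE ?powR_ge0 // invr_ge0 ltW.
by rewrite -(ler_nat R); apply: le_trans le_HC (ltW (archi_boundP (powR_ge0 _ _))).
Qed.

Lemma sqrt_le_powR (z : int) (n : nat) : (`|z| <= p ^ n)%N ->
  Num.sqrt `|z%:~R| <= p%:R `^ (n%:R / 2) :> R.
Proof.
move=> le_z; rewrite powRrM powR12_sqrt ?powR_ge0 // (powR_mulrn _ (ltW p_gt0)).
by rewrite ler_wsqrtr // -intr_norm -natr_absz -natrX ler_nat.
Qed.

Lemma fib_early_size k :
  (`|(fib_num p k * fib_den p k)%R| <= p ^ (2 * fib_len k + 1))%N.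
Proof.
rewrite abszM (_ : 2 * fib_len k + 1 = (fib_len k).+1 + fib_len k)%N; last by lia.
by rewrite expnD leq_mul // ltnW ?fib_num_lt ?fib_den_lt.
Qed.

Lemma fib_late_size k :
  (`|(fib_num_late p k * fib_den p k)%R| <=
    p ^ (fib_len k.+2 + fib_len k + 1))%N.
Proof.
rewrite abszM addn1 -addSn expnD leq_mul // ltnW ?fib_num_late_lt //.
by rewrite fib_den_lt.
Qed.

Lemma mu_times_ge : ((g ^+ 2 + 1 / (1 + g ^+ 2))%:E <= mu_times R xi)%E.
Proof.
have /andP[g1 g2] := golden_bounds R; have gg := golden_sqr R.
have q0 : 0 < 1 + g ^+ 2 by rewrite gg; lra.
(* The late run has order about 2 L_(k+2) and size exponent about (L_(k+2) + L_k) / 2; their ratio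
   tends to 4 g^2 / (1 + g^2). *)
have tE : (g ^+ 2 + 1 / (1 + g ^+ 2)) * (1 + g ^+ 2) = 4 * g ^+ 2.
  rewrite mulrDl mul1r mulVf ?gt_eqF // gg.
  by have := gg; lra.
set t := g ^+ 2 + _ in tE *.
have t0 : 0 < t by rewrite -(pmulr_lgt0 _ q0) tE gg; lra.
apply: (le_ereal_sup_fin _ 0) => // m /andP[m0 mt]; apply: infinite_int_pairs => M.
have e0 : 0 < 4 * g ^+ 2 - m * (1 + g ^+ 2).
  by rewrite -tE -mulrBl mulr_gt0 // subr_gt0.
(* The constant collects the errors of replacing L_(k+1) by g L_k on both sides of m (L_(k+2) + L_k
   + 1) <= 4 L_(k+2) - 2. *)
have [K large] := fib_len_large R _ (2 * m + 6) e0.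
pose k := maxn 2 (maxn M K).
have k2 : (1 < k)%N by rewrite leq_max.
have {}large := large k ltac:(by rewrite !leq_max leqnn !orbT).
exists (fib_num_late p k, fib_den p k); last first.
  by apply: leq_ltn_trans (fib_den_gt p p_prime k); rewrite !leq_max leqnn !orbT.
have num0 := fib_num_late_neq0 p p_prime k k2; have den0 := fib_den_neq0 p p_prime k.
split=> //; first by rewrite padic_norm_linear_form_gt0 ?num0.
rewrite -intrM.
apply: (padic_norm_le_powR _ (2 * fib_len k.+2 - 1) _
         ((fib_len k.+2 + fib_len k + 1)%:R / 2)).
- by rewrite sqrtr_gt0 normr_gt0 intr_eq0 mulf_neq0.
- exact/sqrt_le_powR/fib_late_size.
- exact: ltW.
- have /ler_normlP[lo hi] := fib_len_golden R k.
  rewrite natrB ?natrM ?natrD; last by rewrite muln_gt0 fib_len_gt0.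
  move: lo hi large; rewrite fib_lenSS gg.
  move: (fib_len k.+1)%:R (fib_len k)%:R => y x lo hi large.
  have := ler_wpM2r (ltW m0) hi; lra.
by apply/xi_fib_residueP; exact: fib_approx_late.
Qed.

Lemma fib_len_bracket (x : R) (K : nat) : (fib_len K)%:R + 1 <= x ->
  exists2 k, (K <= k)%N & (fib_len k)%:R + 1 <= x < (fib_len k.+1)%:R + 1.
Proof.
move=> le_x.
have ex_k : exists k, x < (fib_len k.+1)%:R + 1.
  exists (Num.bound `|x|); apply: le_lt_trans (ler_norm _) _.
  apply: lt_trans (archi_boundP (normr_ge0 _)) _.
  by rewrite natr1 ltr_nat ltnS; apply: leq_trans (ltnW (fib_len_gt _)).
case: (ex_minnP ex_k) => k lt_x min_k.
have le_k : (K <= k)%N.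
  rewrite leqNgt; apply/negP => lt_k.
  move: (le_lt_trans le_x lt_x); rewrite ltrD2r ltr_nat ltnNge.
  by rewrite fib_len_mono.
exists k => //; rewrite lt_x andbT.
case: k {lt_x} min_k le_k => [|k] min_k le_k.
  by move: le_k; rewrite leqn0 => /eqP <-.
by rewrite leNgt; apply/negP => /min_k; rewrite ltnn.
Qed.

(* For p ^ (fib_len k + 1) <= X the early run of period fib_len k serves until
   the late run of period fib_len k.-1 becomes available; from then on the
   latter, multiplied by the largest admissible power of p, is better. *)
Lemma mu_hat_times_ge :
  ((2 + 1 / (2 * g))%:E <= mu_hat_times R xi)%E.
Proof.
have /andP[g1 g2] := golden_bounds R; have gg := golden_sqr R.
have -> : 2 + 1 / (2 * g) = (g + 3) / 2.
  have g0 : g != 0 by rewrite gt_eqF //; lra.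
  have : g^-1 = g - 1.
    by apply: (mulfI g0); rewrite mulfV // mulrBr mulr1 -expr2 gg; ring.
  by rewrite div1r [(2 * g)^-1]invfM => ->; lra.
apply: (le_ereal_sup_fin _ 1); first by lra.
move=> m /andP[m1 mt]; have m0 : 0 < m := lt_trans ltr01 m1.
(* In the early branch the slack is (5 - 3 g) / 4 >= 1/32 times L_(k+1), and 200 is enough to absorb
   the bounded errors. *)
have [K1 large1] := fib_len_large R 1 200 ltr01.
have [K2 large2] := fib_len_large R ((g + 3) / 2 - m) (m + 3)
  ltac:(by rewrite subr_gt0).
pose K := maxn 3 (maxn K1 K2).
pose X0 : R := p%:R `^ ((fib_len K)%:R + 1).
have X0_gt0 : 0 < X0 by rewrite powR_gt0.
exists X0; split; first exact: gtr0_real.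
move=> X lt_X; have X_gt0 := lt_trans X0_gt0 lt_X.
have lnp : 0 < ln (p%:R : R) by rewrite ln_gt0 // ltr1n.
pose x := ln X / ln p%:R.
have XE : X = p%:R `^ x.
  by rewrite /powR (gt_eqF p_gt0) /x divfK ?gt_eqF // lnK // posrE.
have le_x : (fib_len K)%:R + 1 <= x.
  rewrite leNgt; apply/negP => /ltW lt_x.
  by move: lt_X; rewrite ltNge XE /X0 ler_powR.
have [[|k] le_k /andP[le_x_k lt_x_k]] := fib_len_bracket x K le_x.
  by move: le_k; rewrite geq_max.
have {large1} := large1 k.+1
  ltac:(by apply: leq_trans le_k; rewrite !leq_max leqnn !orbT).
have {large2} := large2 k.+2
  ltac:(by apply/leqW/(leq_trans _ le_k); rewrite !leq_max leqnn !orbT).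
have k2 : (1 < k)%N by move: le_k; rewrite geq_max => /andP[].
have k3 : (1 < k.+1)%N by rewrite ltnW.
have /ler_normlP[lo hi] := fib_len_golden R k.+1.
move=> large2 large1.
(* The late approximation of period L_k is admissible as soon as x, the logarithm of X to base p,
   reaches c. *)
pose c : R := (fib_len k.+2 + fib_len k + 1)%:R / 2.
have cE : c = ((fib_len k.+2)%:R + (fib_len k)%:R + 1) / 2 by rewrite /c !natrD.
have gy := congr1 (fun u => u * (fib_len k.+1)%:R) gg.
have zE := fib_lenSS R k.
have [lt_c|le_c] := ltP x c.
  exists (fib_num p k.+1), (fib_den p k.+1); rewrite -intrM; split.
  - by rewrite sqrtr_gt0 normr_gt0 intr_eq0 mulf_neq0 ?fib_num_neq0 ?fib_den_neq0.
  - rewrite XE; apply: le_trans (sqrt_le_powR _ _ (fib_early_size k.+1)) _.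
    by rewrite ler_powR // natrD natrM; lra.
  apply: (padic_norm_le_powR _ (fib_len k.+3 - 1) _ x) => //.
  - by rewrite XE.
  - exact: ltW.
  - rewrite natrB; last by rewrite ltnW ?fib_len_gt1.
    rewrite (fib_lenSS R k.+1).
    have c0 : 0 <= c by rewrite divr_ge0.
    have xc : x * m <= c * ((g + 3) / 2).
      by apply: le_trans (ler_wpM2l c0 (ltW mt)); apply: ler_wpM2r; exact: ltW.
    have cy : c * ((g + 3) / 2) <=
        ((g - 1 / 2) * (fib_len k.+1)%:R + 3 / 2) * ((g + 3) / 2).
      by apply: ler_wpM2r; [lra | rewrite cE; lra].
    have gy' : g * (fib_len k.+1)%:R <= 13 / 8 * (fib_len k.+1)%:R.
      by rewrite ler_wpM2r // ltW.
    apply: (le_trans xc); apply: (le_trans cy).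
    by lra.
  by apply/xi_fib_residueP; exact: fib_approx_early.
pose j := Num.truncn (x - c).
have /andP[j1 j2] : j%:R <= x - c < j.+1%:R by rewrite truncn_itv // subr_ge0.
pose q : int := p%:Z ^+ j.
have q0 : q != 0 by rewrite expf_neq0 // eqz_nat -lt0n prime_gt0.
exists (q * fib_num_late p k), (q * fib_den p k); rewrite -intrM; split.
- by rewrite sqrtr_gt0 normr_gt0 intr_eq0 !mulf_neq0 ?fib_num_late_neq0 ?fib_den_neq0.
- rewrite XE; apply: le_trans
    (sqrt_le_powR _ (2 * j + (fib_len k.+2 + fib_len k + 1)) _) _.
    rewrite mulrACA abszM expnD leq_mul ?fib_late_size //.
    by rewrite abszM abszX -expnD addnn mul2n.
  by rewrite ler_powR // natrD natrM -/c; move: j1; rewrite /c; lra.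
apply: (padic_norm_le_powR _ (j + (2 * fib_len k.+2 - 1)) _ x) => //.
- by rewrite XE.
- exact: ltW.
- rewrite natrD natrB ?natrM; last by rewrite muln_gt0 fib_len_gt0.
  rewrite -natr1 in j2.
  (* Up to constants, x (m - 1) <= 2 L_(k+2) - c is needed. The worst x is the right end L_(k+2) +
     1, which produces the exponent 3 - (2 g - 1) / (2 g) = 2 + 1 / (2 g). *)
  have xm : x * (m - 1) <= ((fib_len k.+2)%:R + 1) * (m - 1).
    by apply: ler_wpM2r; [rewrite subr_ge0 ltW | exact: ltW].
  have yl : (g - 1) * ((fib_len k.+2)%:R - 1) <=
      (g - 1) * (g * (fib_len k.+1)%:R).
    by apply: ler_wpM2l; lra.
  clear -g1 g2 large2 gy zE xm yl cE j2.
  by move: (x) (c) (j%:R) xm cE j2 => u v w xm cE j2; lra.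
apply/xi_fib_residueP; rewrite -mulrA -mulrBr exprD dvdz_mul //.
set N := (2 * fib_len k.+2 - 1)%N.
rewrite (_ : _ - _ = (fib_den p k * T N - fib_num_late p k) +
  fib_den p k * (T (j + N) - T N)); last by ring.
apply: rpredD; first exact: fib_approx_late.
exact/dvdz_mull/digit_sum_mod/leq_addl.
Qed.
End Exponents.

Theorem theorem7p1 (R : realType) (p : nat) (hp : prime p) :
  let gamma := golden R in
  [/\ mu R (xi_fib p) = (gamma ^+ 2)%:E,
      ((gamma ^+ 2 + 1 / (1 + gamma ^+ 2))%:E <= mu_times R (xi_fib p))%E &
      ((2 + 1 / (2 * gamma))%:E <= mu_hat_times R (xi_fib p))%E].
Proof.
move=> gamma; split; last 2 first.
- exact: mu_times_ge.
- exact: mu_hat_times_ge.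
by apply/eqP; rewrite eq_le mu_le // mu_ge.
Qed.
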